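(* Let $u_1,v_1,\delta_x,\delta_y\in\mathbb{R}$, and put $u_2=u_1+1$, $v_2=v_1$. Suppose that $\alpha>0$, $\theta\in(-\pi/2,\pi/2)$, $\sigma,\eta\in\{1,-1\}$, $u_0,v_0\in\mathbb{R}$ and $t_1<t_2$ are such that the curve $$\begin{pmatrix} x(t)\\ y(t)\end{pmatrix}=\frac{1}{\alpha^2}\begin{pmatrix}\cos\theta&-\sin\theta\\ \sin\theta&\cos\theta\end{pmatrix}\begin{pmatrix}\sigma&0\\0&\eta\end{pmatrix}\begin{pmatrix} f(\alpha t)+u_0\,\alpha t\\ g(\alpha t)+v_0\,\alpha t\end{pmatrix},\qquad t_1\le t\le t_2,$$ satisfies the boundary conditions $$(x'(t_1),y'(t_1))=(u_1,v_1),\qquad (x'(t_2),y'(t_2))=(u_2,v_2),\qquad (x(t_2)-x(t_1),\,y(t_2)-y(t_1))=(\delta_x,\delta_y)$$ and minimizes the total time $t_2-t_1$ among all planar trajectories with acceleration bounded by $|(x'',y'')|\le 1$ satisfying these boundary conditions ($t_1<t_2$ free). Then $\alpha<\Lambda(T_{\max},\theta)$, where, with $\mu_1=|(u_1,v_1)|$ and $\mu_2=|(u_2,v_2)|$ (Euclidean norms), $$T_{\max}=\mu_1+\mu_2+\sqrt{2}\left((2\delta_x-\mu_1u_1-\mu_2u_2)^2+(2\delta_y-\mu_1v_1-\mu_2v_2)^2\right)^{1/4}.$$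
   Context: The functions $f,g:\mathbb{R}\to\mathbb{R}$ are $f(t)=t\,\mathrm{arcsinh}(t)-\sqrt{1+t^2}$ and $g(t)=\frac12\left(t\sqrt{1+t^2}+\mathrm{arcsinh}(t)\right)$, so that $f'(t)=\mathrm{arcsinh}(t)$ and $g'(t)=\sqrt{1+t^2}$. For $T>1$ and $-\pi/2<\theta<\pi/2$, define $$\Lambda(T,\theta)=\sup\{\alpha>0 : \alpha T>\exp(\alpha\cos\theta/2)-1\}.$$ Trajectories with bounded acceleration are curves with Lipschitz velocity for which $|(x'',y'')|\le 1$ almost everywhere. (Under the hypotheses of the claim $T_{\max}>1$, so $\Lambda(T_{\max},\theta)$ is defined.) *)

(* Defs.v *)
From HB Require Import structures.
From mathcomp Require Import all_boot all_order all_algebra.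
From mathcomp Require Import all_classical all_reals all_analysis.
From mathcomp Require Import ring lra.
Set Implicit Arguments.
Unset Strict Implicit.
Unset Printing Implicit Defensive.
Import Order.TTheory GRing.Theory Num.Theory.
Import numFieldNormedType.Exports.

Local Open Scope classical_set_scope.
Local Open Scope ring_scope.

Definition enorm (R : realType) (a b : R) : R := Num.sqrt (a ^+ 2 + b ^+ 2).

Definition arcsinh (R : realType) (t : R) : R := ln (t + Num.sqrt (1 + t ^+ 2)).

Lemma arcsinhK (R : realType) (t : R) :
  (expR (arcsinh t) - expR (- arcsinh t)) / 2 = t.
Proof.
have t2 : 0 < 1 + t ^+ 2 by rewrite ltr_wpDr // sqr_ge0.
have s2 : Num.sqrt (1 + t ^+ 2) ^+ 2 = 1 + t ^+ 2 by rewrite sqr_sqrtr // ltW.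
have p0 : 0 < t + Num.sqrt (1 + t ^+ 2).
  rewrite -ltrBlDl sub0r (le_lt_trans (ler_norm _)) // normrN -sqrtr_sqr.
  by rewrite ltr_sqrt // ltrDr.
rewrite expRN /arcsinh lnK ?posrE//.
rewrite (_ : _^-1 = Num.sqrt (1 + t ^+ 2) - t); first by field.
apply: (mulfI (lt0r_neq0 p0)); rewrite divff ?lt0r_neq0//.
transitivity (Num.sqrt (1 + t ^+ 2) ^+ 2 - t ^+ 2); last by ring.
by rewrite s2 addrK.
Qed.

Definition fcrv (R : realType) (t : R) : R :=
  t * arcsinh t - Num.sqrt (1 + t ^+ 2).

Definition gcrv (R : realType) (t : R) : R :=
  2^-1 * (t * Num.sqrt (1 + t ^+ 2) + arcsinh t).

Definition curve_x (R : realType) (alpha theta sigma eta u0 v0 t : R) : R :=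
  alpha ^- 2 *
    (cos theta * (sigma * (fcrv (alpha * t) + u0 * (alpha * t)))
     - sin theta * (eta * (gcrv (alpha * t) + v0 * (alpha * t)))).

Definition curve_y (R : realType) (alpha theta sigma eta u0 v0 t : R) : R :=
  alpha ^- 2 *
    (sin theta * (sigma * (fcrv (alpha * t) + u0 * (alpha * t)))
     + cos theta * (eta * (gcrv (alpha * t) + v0 * (alpha * t)))).

(* Curves parametrised by [a, b] are represented by total functions of which
   only the restriction to [a, b] matters: difference quotients are taken along
   points of [a, b], hence one-sidedly at the two endpoints. *)
Definition diff_quot (R : realType) (x : R -> R) (t s : R) : R :=
  (x s - x t) / (s - t).

Definition differentiable_in (R : realType) (a b : R) (x : R -> R) : Prop :=
  forall t, t \in `[a, b] -> cvg (diff_quot x t @ within `[a, b] t^').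

Definition velocity (R : realType) (a b : R) (x : R -> R) (t : R) : R :=
  lim (diff_quot x t @ within `[a, b] t^').

Lemma velocityE (R : realType) (a b : R) (x : R -> R) (t : R) :
  a < b -> t \in `[a, b] -> derivable x t 1 -> velocity a b x t = derive1 x t.
Proof.
move=> ab tab dx.
have PF : ProperFilter (within `[a, b] t^').
  apply: Build_ProperFilter_ex => A.
  rewrite /within /= /dnbhs /within /= => /nbhs_ballP[e /= e0 H].
  have [ta tb] : a <= t /\ t <= b by move: tab; rewrite in_itv => /andP[].
  have [tb'|bt] := ltP t b.
  - exists (t + Num.min (e / 2) (b - t)).
    have m0 : 0 < Num.min (e / 2) (b - t).
      by rewrite lt_min divr_gt0 // subr_gt0.
    have me : Num.min (e / 2) (b - t) <= e / 2 by rewrite ge_min lexx.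
    have mb : Num.min (e / 2) (b - t) <= b - t by rewrite ge_min lexx orbT.
    apply: H; last by rewrite in_itv /=; apply/andP; split; lra.
      rewrite /ball /= opprD addNKr normrN gtr0_norm //; lra.
    by rewrite gt_eqF // ltrDl.
  - exists (t - Num.min (e / 2) (t - a)).
    have m0 : 0 < Num.min (e / 2) (t - a).
      by rewrite lt_min divr_gt0 // subr_gt0 (lt_le_trans ab).
    have me : Num.min (e / 2) (t - a) <= e / 2 by rewrite ge_min lexx.
    have mb : Num.min (e / 2) (t - a) <= t - a by rewrite ge_min lexx orbT.
    apply: H; last by rewrite in_itv /=; apply/andP; split; lra.
      rewrite /ball /= opprB addrC subrK gtr0_norm //; lra.
    by rewrite lt_eqF // ltrBlDr ltrDl.
apply/cvg_lim => //; apply: cvg_within_filter.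
apply/cvgrPdist_lt => e e0.
have : h^-1 *: (x (h + t) - x t) @[h --> 0^'] --> derive1 x t.
  by move: dx; rewrite /derivable /derive1 /=; under eq_fun do rewrite [_ *: 1]mulr1.
move=> /cvgrPdist_lt/(_ _ e0).
rewrite /dnbhs !near_withinE => /nbhs_ballP[d /= d0 H].
apply/nbhs_ballP; exists d => //= s ts st.
have := H (s - t); rewrite /ball /= sub0r opprB subr_eq0 => /(_ ts st).
by rewrite subrK /diff_quot [_^-1 *: _]mulrC.
Qed.

(* The endpoints form a null set, so the acceleration bound is only asked on
   the open interval, where velocity has an ordinary derivative. *)
Definition bounded_acc_trajectory (R : realType) (a b : R) (x y : R -> R)
    : Prop :=
  [/\ differentiable_in a b x,
      differentiable_in a b y,
      [lipschitz velocity a b x t | t in `[a, b]],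
      [lipschitz velocity a b y t | t in `[a, b]] &
      {ae lebesgue_measure, forall t : R, t \in `]a, b[ ->
        [/\ derivable (velocity a b x) t 1,
            derivable (velocity a b y) t 1 &
            enorm (derive1 (velocity a b x) t) (derive1 (velocity a b y) t) <= 1]}].

Definition boundary_conditions (R : realType) (u1 v1 u2 v2 dx dy : R)
    (a b : R) (x y : R -> R) : Prop :=
  [/\ (velocity a b x a, velocity a b y a) = (u1, v1),
      (velocity a b x b, velocity a b y b) = (u2, v2) &
      (x b - x a, y b - y a) = (dx, dy)].

Definition admissible (R : realType) (u1 v1 u2 v2 dx dy : R)
    (a b : R) (x y : R -> R) : Prop :=
  [/\ a < b, bounded_acc_trajectory a b x y &
      boundary_conditions u1 v1 u2 v2 dx dy a b x y].

Definition time_minimizer (R : realType) (u1 v1 u2 v2 dx dy : R)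
    (t1 t2 : R) (x y : R -> R) : Prop :=
  admissible u1 v1 u2 v2 dx dy t1 t2 x y /\
  forall (s1 s2 : R) (X Y : R -> R),
    admissible u1 v1 u2 v2 dx dy s1 s2 X Y -> t2 - t1 <= s2 - s1.

(* For T > 1 and cos theta > 0 the set is nonempty and bounded above, so that
   the real-valued sup is the genuine supremum. *)
Definition Lambda (R : realType) (T theta : R) : R :=
  sup [set alpha : R |
        0 < alpha /\ expR (alpha * cos theta / 2) - 1 < alpha * T].

Definition Tmax (R : realType) (u1 v1 u2 v2 dx dy : R) : R :=
  let mu1 := enorm u1 v1 in
  let mu2 := enorm u2 v2 in
  mu1 + mu2 + Num.sqrt 2 *
    ((2 * dx - mu1 * u1 - mu2 * u2) ^+ 2
     + (2 * dy - mu1 * v1 - mu2 * v2) ^+ 2) `^ (4^-1).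

(* Main.v *)
Require Import Defs.
From mathcomp Require Import all_boot all_order all_algebra.
From mathcomp Require Import all_classical all_reals all_analysis.
From mathcomp Require Import ring lra.
Import Order.TTheory GRing.Theory Num.Theory.
Import numFieldNormedType.Exports.
Set Implicit Arguments.
Unset Strict Implicit.
Unset Printing Implicit Defensive.
Local Open Scope ring_scope.

(** The minimal time [T = t2 - t1] is squeezed between a lower bound read off
the curve and an upper bound given by an explicit competitor.

Lower bound.  Differentiating the curve, its velocity gain is the rotation by
[theta] of [(sigma * da, eta * ds) / alpha], where [da] and [ds] are the
increments of [arcsinh] and of [sqrt (1 + t^2)] between [alpha * t1] and
[alpha * t2].  The prescribed gain is [(1, 0)], so rotating back yields
[sigma * da = alpha * cos theta] ([curve_velocity_gain]).  The hyperbolic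
identity [sinh b - sinh a = 2 cosh ((a + b) / 2) sinh ((b - a) / 2)] together
with [cosh >= 1] ([arcsinh_gap]) first forces [sigma = 1], because
[alpha * T > 0], and then gives, with [h = alpha * cos theta / 2],
[alpha * T >= exp h - exp (- h) > exp h - 1].

Upper bound.  One admissible trajectory brakes from [(u1, v1)] to rest in time
[mu1], travels from rest to rest by accelerating and then braking along a
straight line, and finally accelerates from rest to [(u2, v2)] in time [mu2].
The two outer phases cover [mu1 * (u1, v1) / 2] and [mu2 * (u2, v2) / 2]; the
middle one has to cover the remaining vector [d], which takes [2 * sqrt |d|].
The total is exactly [Tmax] ([admissible_Tmax]), hence [T <= Tmax].

Together, [alpha * Tmax > exp (alpha * cos theta / 2) - 1].  The set of such
[alpha] is open and, since [cos theta > 0], bounded above, so each of its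
points is strictly below its supremum ([lt_Lambda]). *)

(** * Trajectories with prescribed derivatives *)

Lemma diff_quot_cvg (R : realType) (a b : R) (x : R -> R) (t v : R) :
  is_derive t 1 x v -> cvg_to (diff_quot x t @ within `[a, b] t^')%classic
    (nbhs v).
Proof.
move=> xv; apply: cvg_within_filter; apply/cvgrPdist_lt => e e0.
have : (h^-1 *: (x (h + t) - x t) @[h --> 0^'] --> v)%classic.
  have := @ex_derive _ _ _ _ _ _ _ xv; rewrite -(@derive_val _ _ _ _ _ _ _ xv).
  by rewrite /derivable /derive /=; under eq_fun do rewrite [_ *: 1]mulr1.
move=> /cvgrPdist_lt/(_ _ e0).
rewrite /dnbhs !near_withinE => /nbhs_ballP[d /= d0 H].
apply/nbhs_ballP; exists d => //= s ts st.
have := H (s - t); rewrite /ball /= sub0r opprB subr_eq0 => /(_ ts st).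
by rewrite subrK /diff_quot [_^-1 *: _]mulrC.
Qed.

Lemma velocity_is_derive (R : realType) (a b : R) (x : R -> R) (t v : R) :
  a < b -> t \in `[a, b] -> is_derive t 1 x v -> velocity a b x t = v.
Proof.
move=> ab tab xv; rewrite velocityE //.
by rewrite derive1E derive_val.
Qed.

Lemma velocity_lipschitz (R : realType) (a b k : R) (x v : R -> R) :
  a < b -> (forall t : R, is_derive t 1 x (v t)) ->
  (forall s t, `|v s - v t| <= k * `|s - t|) ->
  [lipschitz velocity a b x t | t in `[a, b]%classic].
Proof.
move=> ab xv vk; apply: (@klipschitzW _ _ _ k).
  apply: (@globally_properfilter _ _ (a, a)).
  by split; rewrite /= in_itv /= lexx ltW.
move=> [s t] [/= sab tab].
by rewrite !(velocity_is_derive ab _ (xv _)).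
Qed.

Lemma is_derive_velocity (R : realType) (a b : R) (x v : R -> R) (t w : R) :
  t \in `]a, b[ -> (forall s : R, is_derive s 1 x (v s)) ->
  is_derive t 1 v w -> is_derive t 1 (velocity a b x) w.
Proof.
move=> tab xv; apply: near_eq_is_derive.
apply: filterS (near_in_itvoo tab) => s sab.
apply/esym/velocity_is_derive => //; last exact: subset_itv_oo_cc.
by move: tab; rewrite in_itv /= => /andP[]; apply: lt_trans.
Qed.

(** Reduces the acceleration bound, which concerns the limit-defined velocity,
to pointwise derivatives of explicit functions; the breakpoints of a piecewise
trajectory go into the null set [S]. *)
Lemma trajectory_of_derivatives (R : realType) (a b k : R)
    (x y vx vy ax ay : R -> R) (S : set R) :
  a < b ->
  (forall t : R, is_derive t 1 x (vx t)) ->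
  (forall t : R, is_derive t 1 y (vy t)) ->
  (forall s t, `|vx s - vx t| <= k * `|s - t|) ->
  (forall s t, `|vy s - vy t| <= k * `|s - t|) ->
  countable S ->
  (forall t, t \in `]a, b[ -> ~ S t ->
    [/\ is_derive t 1 vx (ax t), is_derive t 1 vy (ay t) &
        enorm (ax t) (ay t) <= 1]) ->
  bounded_acc_trajectory a b x y.
Proof.
move=> ab xv yv xk yk cS acc; split.
- by move=> t _; apply/cvg_ex; exists (vx t); apply: diff_quot_cvg.
- by move=> t _; apply/cvg_ex; exists (vy t); apply: diff_quot_cvg.
- exact: velocity_lipschitz xk.
- exact: velocity_lipschitz yk.
- exists S; split; last first.
  2: exact: countable_lebesgue_measure0.
  2: by apply: countable_measurable => //= t; exact: measurable_set1.
  move=> t /=; apply: contra_notP => St tab.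
  have [vx' vy' le1] := acc t tab St.
  have Dx := is_derive_velocity tab xv vx'.
  have Dy := is_derive_velocity tab yv vy'.
  by split=> //; rewrite !derive1E !derive_val.
Qed.

(** * Piecewise quadratic motions *)

(** Ramps turn a piecewise affine velocity into a single closed formula, so that
no gluing of trajectories at the breakpoints is required. *)
Definition ramp (R : realType) (t : R) : R := Num.max t 0.

Lemma ramp_ge0 (R : realType) (t : R) : 0 <= t -> ramp t = t.
Proof. by move=> t0; rewrite /ramp max_l. Qed.

Lemma ramp_le0 (R : realType) (t : R) : t <= 0 -> ramp t = 0.
Proof. by move=> t0; rewrite /ramp max_r. Qed.

Lemma ramp_lipschitz (R : realType) (s t : R) : `|ramp s - ramp t| <= `|s - t|.
Proof.
have [s0|s0] := leP 0 s; have [t0|t0] := leP 0 t;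
  rewrite ?(ramp_ge0 s0) ?(ramp_ge0 t0) ?(ramp_le0 (ltW s0)) ?(ramp_le0 (ltW t0)) //.
- by rewrite !ger0_norm; lra.
- by rewrite ler0_norm ?(@ler0_norm _ (s - t)); lra.
- by rewrite subrr normr0.
Qed.

Lemma is_derive_ramp (R : realType) (t : R) :
  t != 0 -> is_derive t 1 (@ramp R) (0 < t)%R%:R.
Proof.
rewrite neq_lt => /orP[t0|t0].
- rewrite ltNge (ltW t0) /=; apply: (@near_eq_is_derive _ _ _ (fun=> 0)).
  near=> s; rewrite ramp_le0 //; near: s; exact: lt_le_nbhsl.
- rewrite t0 /=; apply: (@near_eq_is_derive _ _ _ id).
  near=> s; rewrite ramp_ge0 //; near: s; exact: lt_le_nbhsr.
Unshelve. all: by end_near. Qed.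

(** Away from 0 the chain rule applies; at 0, where [ramp] has a corner, the
difference quotient of the half square is [ramp s / 2], which is continuous. *)
Lemma is_derive_ramp2 (R : realType) (t : R) :
  is_derive t 1 (fun s : R => ramp s ^+ 2 / 2) (ramp t).
Proof.
have [->|t0] := eqVneq t 0.
  apply/is_derive1_caratheodory; exists (fun s => ramp s / 2).
  rewrite /ramp maxxx mul0r; split => // [s|].
    have [s0|s0] := leP s 0; first by rewrite mul0r expr2 !mul0r subrr.
    by field.
  move=> s; apply: cvgMl; apply: continuous_max => //; exact: cvg_cst.
have dr := is_derive_ramp t0.
apply: is_derive_eq; rewrite /GRing.scale /=.
have [t1|t1] := ltP 0 t; rewrite /=; first by field.
by rewrite ramp_le0 //; ring.
Qed.

(** One coordinate of a motion starting with velocity [u] and acceleration [c0],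
whose acceleration jumps by [c1], [c2], [c3] at the times [s1], [s2], [s3]. *)
Definition spline_acc (R : realType) (c0 c1 c2 c3 s1 s2 s3 t : R) : R :=
  c0 + c1 * (0 < t - s1)%R%:R + c2 * (0 < t - s2)%R%:R + c3 * (0 < t - s3)%R%:R.

Definition spline_vel (R : realType) (u c0 c1 c2 c3 s1 s2 s3 t : R) : R :=
  u + c0 * t + c1 * ramp (t - s1) + c2 * ramp (t - s2) + c3 * ramp (t - s3).

Definition spline_pos (R : realType) (u c0 c1 c2 c3 s1 s2 s3 t : R) : R :=
  u * t + c0 * (t ^+ 2 / 2) + c1 * (ramp (t - s1) ^+ 2 / 2)
  + c2 * (ramp (t - s2) ^+ 2 / 2) + c3 * (ramp (t - s3) ^+ 2 / 2).

Lemma is_derive_shift (R : realType) (f : R -> R) (s t v : R) :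
  is_derive (t - s) 1 f v -> is_derive t 1 (fun r => f (r - s)) v.
Proof.
move=> fv.
rewrite -[v]mulr1; apply: (@is_derive1_comp _ f (fun r => r - s)) => //.
by apply: is_derive_eq; rewrite oppr0 addr0.
Qed.

Section Spline.
Variables (R : realType) (u c0 c1 c2 c3 s1 s2 s3 : R).

Lemma is_derive_spline_pos (t : R) :
  is_derive t 1 (spline_pos u c0 c1 c2 c3 s1 s2 s3)
    (spline_vel u c0 c1 c2 c3 s1 s2 s3 t).
Proof.
have d s := @is_derive_shift R _ s t _ (is_derive_ramp2 (t - s)).
have d1 := d s1; have d2 := d s2; have d3 := d s3.
rewrite /spline_pos; apply: is_derive_eq.
by rewrite /spline_vel /GRing.scale /=; field.
Qed.

Lemma is_derive_spline_vel (t : R) : t != s1 -> t != s2 -> t != s3 ->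
  is_derive t 1 (spline_vel u c0 c1 c2 c3 s1 s2 s3)
    (spline_acc c0 c1 c2 c3 s1 s2 s3 t).
Proof.
have d s : t != s -> is_derive t 1 (fun r => ramp (r - s)) (0 < t - s)%R%:R.
  by move=> ts; apply: is_derive_shift; apply: is_derive_ramp; rewrite subr_eq0.
move=> /d d1 /d d2 /d d3.
rewrite /spline_vel; apply: is_derive_eq.
by rewrite /spline_acc /GRing.scale /=; ring.
Qed.

Lemma spline_vel_lipschitz (k s t : R) :
  `|c0| + `|c1| + `|c2| + `|c3| <= k ->
  `|spline_vel u c0 c1 c2 c3 s1 s2 s3 s - spline_vel u c0 c1 c2 c3 s1 s2 s3 t|
    <= k * `|s - t|.
Proof.
move=> ck; apply: le_trans (ler_wpM2r (normr_ge0 _) ck).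
rewrite !mulrDl.
have r c h : `|c * ramp (s - h) - c * ramp (t - h)| <= `|c| * `|s - t|.
  rewrite -mulrBr normrM ler_wpM2l //.
  by rewrite (le_trans (ramp_lipschitz _ _)) // opprB addrA subrK.
have -> : spline_vel u c0 c1 c2 c3 s1 s2 s3 s
          - spline_vel u c0 c1 c2 c3 s1 s2 s3 t
  = c0 * (s - t) + (c1 * ramp (s - s1) - c1 * ramp (t - s1))
    + (c2 * ramp (s - s2) - c2 * ramp (t - s2))
    + (c3 * ramp (s - s3) - c3 * ramp (t - s3)) by rewrite /spline_vel; ring.
do 3! (rewrite (le_trans (ler_normD _ _)) // lerD //).
by rewrite normrM.
Qed.

End Spline.

(** * The Euclidean norm *)

Section Enorm.
Variable R : realType.
Implicit Types a b k : R.

Lemma enorm_ge0 a b : 0 <= enorm a b.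
Proof. exact: sqrtr_ge0. Qed.

Lemma sqr_enorm a b : enorm a b ^+ 2 = a ^+ 2 + b ^+ 2.
Proof. by rewrite sqr_sqrtr // addr_ge0 // sqr_ge0. Qed.

Lemma enormN a b : enorm (- a) (- b) = enorm a b.
Proof. by rewrite /enorm !sqrrN. Qed.

Lemma enorm_eq0 a b : enorm a b = 0 -> a = 0 /\ b = 0.
Proof.
move=> /(congr1 (fun z => z ^+ 2)); rewrite sqr_enorm expr0n /= => /eqP.
by rewrite paddr_eq0 ?sqr_ge0 // !sqrf_eq0 => /andP[/eqP -> /eqP ->].
Qed.

(** Only an inequality, because for the zero vector the quotients are 0. *)
Lemma enorm_unit_le1 a b : enorm (a / enorm a b) (b / enorm a b) <= 1.
Proof.
rewrite -(@ler_pXn2r _ 2) ?nnegrE ?enorm_ge0 // expr1n sqr_enorm.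
rewrite !expr_div_n -mulrDl -sqr_enorm.
have [->|n0] := eqVneq (enorm a b) 0; first by rewrite expr0n mul0r.
by rewrite divff ?expf_neq0.
Qed.

(** Valid for the zero vector too, so that motions with an empty phase need no
separate treatment. *)
Lemma enorm_unitK a b :
  a / enorm a b * enorm a b = a /\ b / enorm a b * enorm a b = b.
Proof.
have [n0|n0] := eqVneq (enorm a b) 0; last by rewrite !divfK.
by have [-> ->] := enorm_eq0 n0; rewrite !mul0r.
Qed.

End Enorm.

(** * The competitor that stops, travels and restarts *)

Section StopGo.
Variable R : realType.
Implicit Types u p e q m tau t d : R.

(** The acceleration is [- p] up to time [m1], [e] and then [- e] during two
phases of length [tau], and finally [q]; [u] is the initial velocity. *)
Definition stopgo_pos u p e q m1 tau : R -> R :=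
  spline_pos u (- p) (e + p) (- (2 * e)) (q + e) m1 (m1 + tau) (m1 + 2 * tau).

Definition stopgo_vel u p e q m1 tau : R -> R :=
  spline_vel u (- p) (e + p) (- (2 * e)) (q + e) m1 (m1 + tau) (m1 + 2 * tau).

Definition stopgo_acc p e q m1 tau : R -> R :=
  spline_acc (- p) (e + p) (- (2 * e)) (q + e) m1 (m1 + tau) (m1 + 2 * tau).

Lemma stopgo_start u p e q m1 tau : 0 <= m1 -> 0 <= tau ->
  stopgo_vel u p e q m1 tau 0 = u /\ stopgo_pos u p e q m1 tau 0 = 0.
Proof.
move=> m10 tau0; rewrite /stopgo_vel /stopgo_pos /spline_vel /spline_pos.
rewrite !ramp_le0; [|lra..].
by split; field.
Qed.

(** The hypotheses on [p] and [q] say that the first phase brakes to rest and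
that the last one reaches [u']; the one on [e] that the two middle phases cover
[d] minus the displacements [m1 * u / 2] and [m2 * u' / 2] of the outer ones. *)
Lemma stopgo_end u p e q m1 m2 tau d u' :
  0 <= m1 -> 0 <= m2 -> 0 <= tau ->
  p * m1 = u -> q * m2 = u' ->
  e * tau ^+ 2 = (2 * d - m1 * u - m2 * u') / 2 ->
  stopgo_vel u p e q m1 tau (m1 + m2 + 2 * tau) = u' /\
  stopgo_pos u p e q m1 tau (m1 + m2 + 2 * tau) = d.
Proof.
move=> m10 m20 tau0 pE qE eE.
rewrite /stopgo_vel /stopgo_pos /spline_vel /spline_pos.
rewrite !ramp_ge0; [|lra..].
split; first by rewrite -pE -qE; ring.
have -> : d = e * tau ^+ 2 + (m1 * u + m2 * u') / 2 by rewrite eE; field.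
by rewrite -pE -qE; field.
Qed.

(** The case distinction is made before quantifying over [p], [e], [q], so that
both coordinates are in the same phase at time [t]. *)
Lemma stopgo_acc_cases m1 tau t : 0 <= tau ->
  [\/ forall p e q, stopgo_acc p e q m1 tau t = - p,
      forall p e q, stopgo_acc p e q m1 tau t = e,
      forall p e q, stopgo_acc p e q m1 tau t = - e |
      forall p e q, stopgo_acc p e q m1 tau t = q].
Proof.
move=> tau0; rewrite /stopgo_acc /spline_acc.
case: (ltP 0 (t - m1)) => h1; case: (ltP 0 (t - (m1 + tau))) => h2;
  case: (ltP 0 (t - (m1 + 2 * tau))) => h3; try (exfalso; lra).
- by constructor 4 => p e q /=; ring.
- by constructor 3 => p e q /=; ring.
- by constructor 2 => p e q /=; ring.
- by constructor 1 => p e q /=; ring.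
Qed.

Lemma fourth_root_sqr (a : R) : 0 <= a -> (a `^ 4^-1) ^+ 2 = Num.sqrt a.
Proof.
move=> a0; rewrite -powR_mulrn ?powR_ge0 // -powRrM -powR12_sqrt //.
by congr (_ `^ _); field.
Qed.

(** The three directions are the unit vectors along [(u1, v1)], along the
remaining displacement [(wx, wy) / 2] and along [(u2, v2)]; [tau] is the square
root of the length of that displacement. *)
Lemma admissible_Tmax (u1 v1 u2 v2 dx dy : R) :
  0 < Tmax u1 v1 u2 v2 dx dy ->
  exists X Y : R -> R,
    admissible u1 v1 u2 v2 dx dy 0 (Tmax u1 v1 u2 v2 dx dy) X Y.
Proof.
move=> T0.
set m1 := enorm u1 v1; set m2 := enorm u2 v2.
set wx := 2 * dx - m1 * u1 - m2 * u2; set wy := 2 * dy - m1 * v1 - m2 * v2.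
set N := enorm wx wy.
set tau := Num.sqrt 2 / 2 * (wx ^+ 2 + wy ^+ 2) `^ 4^-1.
have s2 : Num.sqrt 2 ^+ 2 = 2 :> R by rewrite sqr_sqrtr.
have m10 : 0 <= m1 := enorm_ge0 _ _.
have m20 : 0 <= m2 := enorm_ge0 _ _.
have tau0 : 0 <= tau by rewrite mulr_ge0 ?powR_ge0 // divr_ge0 // sqrtr_ge0.
have tau2 : tau ^+ 2 = N / 2.
  rewrite /tau exprMn expr_div_n s2 fourth_root_sqr ?addr_ge0 ?sqr_ge0 //.
  by rewrite -/(enorm wx wy) -/N; field.
have TE : Tmax u1 v1 u2 v2 dx dy = m1 + m2 + 2 * tau.
  by rewrite /Tmax -/m1 -/m2 -/wx -/wy /tau; field.
rewrite TE in T0 *.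
have [ux uy] := enorm_unitK wx wy.
have [u1K v1K] := enorm_unitK u1 v1.
have [u2K v2K] := enorm_unitK u2 v2.
have eX : wx / N * tau ^+ 2 = wx / 2 by rewrite tau2 mulrA ux.
have eY : wy / N * tau ^+ 2 = wy / 2 by rewrite tau2 mulrA uy.
exists (stopgo_pos u1 (u1 / m1) (wx / N) (u2 / m2) m1 tau).
exists (stopgo_pos v1 (v1 / m1) (wy / N) (v2 / m2) m1 tau).
have [X0 X1] := stopgo_start u1 (u1 / m1) (wx / N) (u2 / m2) m10 tau0.
have [Y0 Y1] := stopgo_start v1 (v1 / m1) (wy / N) (v2 / m2) m10 tau0.
have [X2 X3] := stopgo_end m10 m20 tau0 u1K u2K eX.
have [Y2 Y3] := stopgo_end m10 m20 tau0 v1K v2K eY.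
split => //.
(* Each velocity component is Lipschitz, the constant being the sum of the
   absolute values of its initial acceleration and of the three jumps. *)
- pose kof p e q : R := `|- p| + `|e + p| + `|- (2 * e)| + `|q + e|.
  pose kx := kof (u1 / m1) (wx / N) (u2 / m2).
  pose ky := kof (v1 / m1) (wy / N) (v2 / m2).
  apply: (@trajectory_of_derivatives _ _ _ (Num.max kx ky) _ _
    (stopgo_vel u1 (u1 / m1) (wx / N) (u2 / m2) m1 tau)
    (stopgo_vel v1 (v1 / m1) (wy / N) (v2 / m2) m1 tau)
    (stopgo_acc (u1 / m1) (wx / N) (u2 / m2) m1 tau)
    (stopgo_acc (v1 / m1) (wy / N) (v2 / m2) m1 tau)
    [set m1; m1 + tau; m1 + 2 * tau]%classic).
  + exact: T0.
  + exact: is_derive_spline_pos.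
  + exact: is_derive_spline_pos.
  + by move=> s t; apply: spline_vel_lipschitz; rewrite le_max lexx.
  + by move=> s t; apply: spline_vel_lipschitz; rewrite le_max lexx orbT.
  + exact: finite_set_countable.
  move=> t _ /= tS.
  have t1 : t != m1 by apply/eqP => tE; apply: tS; left; left.
  have t2 : t != m1 + tau by apply/eqP => tE; apply: tS; left; right.
  have t3 : t != m1 + 2 * tau by apply/eqP => tE; apply: tS; right.
  split; [exact: is_derive_spline_vel|exact: is_derive_spline_vel|].
  by case: (stopgo_acc_cases m1 t tau0) => accE; rewrite !accE ?enormN
    enorm_unit_le1.
- have vE f g : (forall s : R, is_derive s 1 f (g s)) ->
      velocity 0 (m1 + m2 + 2 * tau) f 0 = g 0 /\
      velocity 0 (m1 + m2 + 2 * tau) f (m1 + m2 + 2 * tau)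
        = g (m1 + m2 + 2 * tau).
    by move=> fg; split; apply: velocity_is_derive => //;
      rewrite in_itv /= lexx ltW.
  have [vX0 vX1] := vE _ _ (is_derive_spline_pos u1 (- (u1 / m1))
    (wx / N + u1 / m1) (- (2 * (wx / N))) (u2 / m2 + wx / N)
    m1 (m1 + tau) (m1 + 2 * tau)).
  have [vY0 vY1] := vE _ _ (is_derive_spline_pos v1 (- (v1 / m1))
    (wy / N + v1 / m1) (- (2 * (wy / N))) (v2 / m2 + wy / N)
    m1 (m1 + tau) (m1 + 2 * tau)).
  split; rewrite ?X1 ?X3 ?Y1 ?Y3 ?subr0 //; congr (_, _).
  + exact: etrans vX0 X0.
  + exact: etrans vY0 Y0.
  + exact: etrans vX1 X2.
  + exact: etrans vY1 Y2.
Qed.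

End StopGo.

(** * Velocity of the extremal curves *)

Section Curve.
Variable R : realType.
Implicit Types t : R.

Lemma is_derive_sqrt1 t :
  is_derive t 1 (fun s : R => Num.sqrt (1 + s ^+ 2)) (t / Num.sqrt (1 + t ^+ 2)).
Proof.
have t2 : 0 < 1 + t ^+ 2 by rewrite ltr_wpDr // sqr_ge0.
have s0 : Num.sqrt (1 + t ^+ 2) != 0 by rewrite gt_eqF // sqrtr_gt0.
have d1 := is_derive1_sqrt t2.
have d2 : is_derive t 1 (fun s : R => 1 + s ^+ 2) (2 * t).
  by apply: is_derive_eq; rewrite /GRing.scale /=; ring.
have d3 : is_derive t 1 (fun s : R => Num.sqrt (1 + s ^+ 2)) _ :=
  @is_derive1_comp _ _ (fun s : R => 1 + s ^+ 2) t _ _ d1 d2.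
apply: is_derive_eq.
by field.
Qed.

Lemma is_derive_arcsinh t :
  is_derive t 1 (@arcsinh R) (Num.sqrt (1 + t ^+ 2))^-1.
Proof.
have t2 : 0 < 1 + t ^+ 2 by rewrite ltr_wpDr // sqr_ge0.
have s0 : Num.sqrt (1 + t ^+ 2) != 0 by rewrite gt_eqF // sqrtr_gt0.
have p0 : 0 < t + Num.sqrt (1 + t ^+ 2).
  rewrite -ltrBlDl sub0r (le_lt_trans (ler_norm _)) // normrN -sqrtr_sqr.
  by rewrite ltr_sqrt // ltrDr.
have d1 := is_derive1_ln p0.
have d2 := is_derive_sqrt1 t.
have d3 : is_derive t 1 (fun s : R => s + Num.sqrt (1 + s ^+ 2))
   (1 + t / Num.sqrt (1 + t ^+ 2)) by apply: is_derive_eq.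
have d4 : is_derive t 1 (fun s : R => arcsinh s) _ :=
  @is_derive1_comp _ _ (fun s : R => s + Num.sqrt (1 + s ^+ 2)) t _ _ d1 d3.
apply: is_derive_eq.
by field; rewrite s0 gt_eqF.
Qed.

Lemma is_derive_fcrv t : is_derive t 1 (@fcrv R) (arcsinh t).
Proof.
have d1 := is_derive_arcsinh t; have d2 := is_derive_sqrt1 t.
rewrite /fcrv; apply: is_derive_eq; rewrite /GRing.scale /=; ring.
Qed.

Lemma is_derive_gcrv t : is_derive t 1 (@gcrv R) (Num.sqrt (1 + t ^+ 2)).
Proof.
have d1 := is_derive_arcsinh t; have d2 := is_derive_sqrt1 t.
have t2 : 0 < 1 + t ^+ 2 by rewrite ltr_wpDr // sqr_ge0.
have s0 : Num.sqrt (1 + t ^+ 2) != 0 by rewrite gt_eqF // sqrtr_gt0.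
have s2 : Num.sqrt (1 + t ^+ 2) ^+ 2 = 1 + t ^+ 2 by rewrite sqr_sqrtr // ltW.
rewrite /gcrv; apply: is_derive_eq; rewrite /GRing.scale /=.
apply: (mulIf s0); set s := Num.sqrt _ in s0 s2 *.
transitivity ((s ^+ 2 + (1 + t ^+ 2)) / 2); first by field.
by rewrite -s2; field.
Qed.

Variables (alpha theta sigma eta u0 v0 : R).
Hypothesis alpha0 : 0 < alpha.

Lemma is_derive_curve t :
  is_derive t 1 (curve_x alpha theta sigma eta u0 v0)
    (alpha^-1 * (cos theta * (sigma * (arcsinh (alpha * t) + u0))
     - sin theta * (eta * (Num.sqrt (1 + (alpha * t) ^+ 2) + v0)))) /\
  is_derive t 1 (curve_y alpha theta sigma eta u0 v0)
    (alpha^-1 * (sin theta * (sigma * (arcsinh (alpha * t) + u0))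
     + cos theta * (eta * (Num.sqrt (1 + (alpha * t) ^+ 2) + v0)))).
Proof.
have d0 : is_derive t 1 (fun s : R => alpha * s) alpha.
  by apply: is_derive_eq; rewrite /GRing.scale /=; ring.
have d1 : is_derive t 1 (fun s : R => fcrv (alpha * s)) _ :=
  @is_derive1_comp _ _ (fun s : R => alpha * s) t _ _
    (is_derive_fcrv (alpha * t)) d0.
have d2 : is_derive t 1 (fun s : R => gcrv (alpha * s)) _ :=
  @is_derive1_comp _ _ (fun s : R => alpha * s) t _ _
    (is_derive_gcrv (alpha * t)) d0.
have a0 : alpha != 0 by rewrite gt_eqF.
by split; rewrite /curve_x /curve_y; apply: is_derive_eq;
  rewrite /GRing.scale /=; field.
Qed.

(** The increment of the velocity is [(1, 0)]; multiplying it by the inverse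
rotation isolates the [arcsinh] component, and the constants [u0], [v0]
cancel. *)
Lemma curve_velocity_gain (t1 t2 u1 v1 : R) : t1 < t2 ->
  (velocity t1 t2 (curve_x alpha theta sigma eta u0 v0) t1,
   velocity t1 t2 (curve_y alpha theta sigma eta u0 v0) t1) = (u1, v1) ->
  (velocity t1 t2 (curve_x alpha theta sigma eta u0 v0) t2,
   velocity t1 t2 (curve_y alpha theta sigma eta u0 v0) t2) = (u1 + 1, v1) ->
  sigma * (arcsinh (alpha * t2) - arcsinh (alpha * t1)) = alpha * cos theta.
Proof.
move=> t12.
have [dx1 dy1] := is_derive_curve t1; have [dx2 dy2] := is_derive_curve t2.
have i1 : t1 \in `[t1, t2] by rewrite in_itv /= lexx ltW.
have i2 : t2 \in `[t1, t2] by rewrite in_itv /= lexx ltW.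
rewrite !(velocity_is_derive t12 i1 dx1, velocity_is_derive t12 i1 dy1).
rewrite !(velocity_is_derive t12 i2 dx2, velocity_is_derive t12 i2 dy2).
set A1 := arcsinh _; set S1 := Num.sqrt _; set A2 := arcsinh _; set S2 := Num.sqrt _.
move=> [<- <-] [ex ey].
have a0 : alpha != 0 by rewrite gt_eqF.
move: (cos2Dsin2 theta) => cs.
set c := cos theta in ex ey cs *; set s := sin theta in ex ey cs.
set P1 := sigma * (A1 + u0) in ex ey; set P2 := sigma * (A2 + u0) in ex ey.
set Q1 := eta * (S1 + v0) in ex ey; set Q2 := eta * (S2 + v0) in ex ey.
have ex' : c * (P2 - P1) - s * (Q2 - Q1) = alpha.
  transitivity (alpha * (alpha^-1 * (c * P2 - s * Q2) - alpha^-1 * (c * P1 - s * Q1))).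
    by field.
  by rewrite ex; ring.
have ey' : s * (P2 - P1) + c * (Q2 - Q1) = 0.
  transitivity (alpha * (alpha^-1 * (s * P2 + c * Q2) - alpha^-1 * (s * P1 + c * Q1))).
    by field.
  by rewrite ey; ring.
(* First component of the inverse rotation applied to the gain. *)
transitivity ((c ^+ 2 + s ^+ 2) * (P2 - P1)); first by rewrite cs /P1 /P2; ring.
transitivity (c * (c * (P2 - P1) - s * (Q2 - Q1)) + s * (s * (P2 - P1) + c * (Q2 - Q1))).
  by ring.
by rewrite ex' ey'; ring.
Qed.

End Curve.


(** * Comparison with the supremum *)

(** The identity [sinh b - sinh a = 2 cosh ((a + b) / 2) sinh ((b - a) / 2)],
the factor [k] being the hyperbolic cosine. *)
Lemma arcsinh_gap (R : realType) (x y h : R) :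
  arcsinh y - arcsinh x = 2 * h ->
  exists2 k, 1 <= k & y - x = k * (expR h - expR (- h)).
Proof.
move=> hE; set m := (arcsinh x + arcsinh y) / 2.
exists ((expR m + expR (- m)) / 2).
  have := expR_gt0 m; rewrite expRN; set E := expR m => E0.
  rewrite -subr_ge0.
  have -> : (E + E^-1) / 2 - 1 = (E - 1) ^+ 2 / (2 * E) by field; rewrite gt_eqF.
  by rewrite divr_ge0 ?sqr_ge0 // mulr_ge0 // ltW.
rewrite -[y in LHS]arcsinhK -[x in LHS]arcsinhK.
have -> : arcsinh y = m + h by rewrite /m; lra.
have -> : arcsinh x = m - h by rewrite /m; lra.
by rewrite opprD opprB addrC !expRD; field.
Qed.

(** [alpha] belongs to the open set whose supremum is [Lambda], hence so does
[alpha + e / 2] for a small [e]; the supremum is genuine because the exponential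
outgrows every linear function. *)
Lemma lt_Lambda (R : realType) (alpha T theta : R) :
  0 < cos theta -> 0 < alpha -> expR (alpha * cos theta / 2) - 1 < alpha * T ->
  alpha < Lambda T theta.
Proof.
set c := cos theta => c0 a0 aT.
pose h (x : R) := x * T - expR (x * (c / 2)).
have ch : {for alpha, continuous h}.
  apply: cvgB; first by apply: cvgMl; exact: cvg_id.
  apply: continuous_comp; first by apply: cvgMl; exact: cvg_id.
  exact: continuous_expR.
have hp : - 1 < h alpha by rewrite /h mulrA; lra.
have [e /= e0 He] : \forall x \near alpha, - 1 < h x.
  exact: (ch _ (lt_nbhsr hp)).
have : - 1 < h (alpha + e / 2).
  by apply: He; rewrite /= opprD addNKr normrN gtr0_norm; lra.
rewrite /h mulrA => hb.
apply: (@lt_le_trans _ _ (alpha + e / 2)); first by lra.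
apply: ub_le_sup; last by split; [lra|rewrite -/c; lra].
(* From [exp y = exp (y / 2) ^ 2 >= (1 + y / 2) ^ 2], with [y = x c / 2]: every
   [x] in the set satisfies [x T > y ^ 2 / 4 = x ^ 2 c ^ 2 / 16]. *)
exists (16 * T / c ^+ 2) => x [x0 xT].
have y0 : 0 < x * c / 2 by rewrite divr_gt0 // mulr_gt0.
have yy := expR_ge1Dx (x * c / 2 / 2).
have E2 : expR (x * c / 2) = expR (x * c / 2 / 2) ^+ 2.
  by rewrite expr2 -expRD; congr expR; field.
rewrite -/c E2 in xT.
rewrite ler_pdivlMr ?exprn_gt0 // -(ler_pM2l x0).
set y := x * c / 2 in y0 yy xT.
have -> : x * (x * c ^+ 2) = 4 * y ^+ 2 by rewrite /y; field.
have : (1 + y / 2) ^+ 2 <= expR (y / 2) ^+ 2.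
  by rewrite ler_pXn2r // nnegrE; [lra|exact: expR_ge0].
nra.
Qed.

Unset Implicit Arguments.

Theorem mainTheorem3 (R : realType) (u1 v1 dx dy u2 v2 : R)
    (hu2 : u2 = u1 + 1) (hv2 : v2 = v1)
    (alpha theta sigma eta u0 v0 t1 t2 : R)
    (halpha : 0 < alpha)
    (htheta : - (pi / 2) < theta /\ theta < pi / 2)
    (hsigma : sigma = 1 \/ sigma = -1)
    (heta : eta = 1 \/ eta = -1)
    (ht : t1 < t2)
    (hmin : time_minimizer u1 v1 u2 v2 dx dy t1 t2
              (curve_x alpha theta sigma eta u0 v0)
              (curve_y alpha theta sigma eta u0 v0)) :
  alpha < Lambda (Tmax u1 v1 u2 v2 dx dy) theta.
Proof.
have c0 : 0 < cos theta by apply: cos_gt0_pihalf; apply/andP.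
have [[_ _ [bc1 bc2 _]] tmin] := hmin.
(* The two end velocities differ, so they are not both zero. *)
have T0 : 0 < Tmax u1 v1 u2 v2 dx dy.
  have r0 : 0 <= Num.sqrt 2 * ((2 * dx - enorm u1 v1 * u1 - enorm u2 v2 * u2) ^+ 2
     + (2 * dy - enorm u1 v1 * v1 - enorm u2 v2 * v2) ^+ 2) `^ (4^-1).
    by rewrite mulr_ge0 ?sqrtr_ge0 ?powR_ge0.
  apply: ltr_pwDl => //; rewrite lt0r addr_ge0 ?enorm_ge0 // andbT.
  rewrite paddr_eq0 ?enorm_ge0 //; apply/negP => /andP[/eqP e1 /eqP e2].
  by have := enorm_eq0 e1; have := enorm_eq0 e2; lra.
have [X [Y XY]] := admissible_Tmax T0.
have := tmin _ _ _ _ XY; rewrite subr0 => tT.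
have aT : alpha * (t2 - t1) <= alpha * Tmax u1 v1 u2 v2 dx dy.
  by rewrite ler_pM2l.
rewrite hu2 hv2 in bc2.
have gain := curve_velocity_gain halpha ht bc1 bc2.
apply: lt_Lambda => //; apply: lt_le_trans aT.
set h := alpha * cos theta / 2.
have h0 : 0 < h by rewrite divr_gt0 // mulr_gt0.
have gap : arcsinh (alpha * t2) - arcsinh (alpha * t1) = 2 * (sigma * h).
  rewrite /h; move: gain; case: hsigma => ->; lra.
have [k k1] := arcsinh_gap gap.
have E1 : 1 < expR h by rewrite expR_gt1.
have F1 : expR (- h) < 1 by rewrite -expR0 ltr_expR oppr_lt0.
have at0 : 0 < alpha * t2 - alpha * t1 by rewrite subr_gt0 ltr_pM2l.
(* For [sigma = -1] the right-hand side of [kE] would be negative. *)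
move=> kE; rewrite mulrBr; move: kE at0; case: hsigma => -> -> at0.
  by rewrite mul1r; nra.
by move: at0; rewrite mulN1r opprK; nra.
Qed.
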